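(* For every integer $d\ge 1$, $$\sup_{n\ge 1}\ \max_{\varnothing\ne u\subseteq\{1,\dots,d\}}\ \sup_{\boldsymbol{k}\in\mathbb{N}_0^u} G_{u,\boldsymbol{k}}(n)\ \le\ \frac12\prod_{j=1}^d\frac{b_j}{b_j-1},$$ where $G_{u,\boldsymbol{k}}(n)$ are the gain coefficients of the Halton points and $b_j$ is the $j$-th prime.
   Context: $\mathbb{N}=\{1,2,\dots\}$, $\mathbb{N}_0=\mathbb{N}\cup\{0\}$. For $j\in\mathbb{N}$, $b_j$ is the $j$-th prime ($b_1=2,b_2=3,b_3=5,\dots$). For $i\in\mathbb{N}_0$ write $i=\sum_{\ell\ge1}a_{ij\ell}b_j^{\ell-1}$ with base-$b_j$ digits $a_{ij\ell}\in\{0,\dots,b_j-1\}$; the (unscrambled) Halton points are $\boldsymbol{a}_i=(a_{i1},\dots,a_{id})\in[0,1)^d$, $i\in\mathbb{N}_0$, with $a_{ij}=\sum_{\ell\ge1}a_{ij\ell}b_j^{-\ell}$. For $u\subseteq\{1,\dots,d\}$, $\mathbb{N}_0^u$ is the set of vectors $\boldsymbol{k}=(k_j)_{j\in u}$ of nonnegative integers indexed by $u$. For non-empty $u\subseteq\{1,\dots,d\}$, $\boldsymbol{k}\in\mathbb{N}_0^u$ and $n\in\mathbb{N}$, the gain coefficient is $$G_{u,\boldsymbol{k}}(n)=\frac1n\prod_{j\in u}\frac1{b_j-1}\ \sum_{i=0}^{n-1}\sum_{i'=0}^{n-1}\prod_{j\in u}\Bigl(b_j\mathbf{1}\{\lfloor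 b_j^{k_j+1}a_{ij}\rfloor=\lfloor b_j^{k_j+1}a_{i'j}\rfloor\}-\mathbf{1}\{\lfloor b_j^{k_j}a_{ij}\rfloor=\lfloor b_j^{k_j}a_{i'j}\rfloor\}\Bigr),$$ where $\mathbf{1}\{A\}$ is $1$ if $A$ holds and $0$ otherwise. *)

(* Defs.v *)
From HB Require Import structures.
From mathcomp Require Import all_boot all_order all_algebra.
From mathcomp Require Import all_classical all_reals all_analysis.

Set Implicit Arguments.
Unset Strict Implicit.
Unset Printing Implicit Defensive.

Import Order.TTheory GRing.Theory Num.Theory.
Import numFieldNormedType.Exports.

Local Open Scope ring_scope.

Lemma next_prime_subproof (m : nat) : exists p, (m < p)%N && prime p.
Proof. by have [p mp pp] := prime_above m; exists p; rewrite mp. Qed.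

Definition next_prime (m : nat) : nat := ex_minn (next_prime_subproof m).

(* [nth_prime j] is b_j, counted from 1: nth_prime 1 = 2, nth_prime 2 = 3, ...
   The value at 0 is only the seed of the recursion. *)
Fixpoint nth_prime (j : nat) : nat :=
  if j is j'.+1 then next_prime (nth_prime j') else 0.

Lemma nth_prime_prime (j : nat) : prime (nth_prime j.+1).
Proof. by rewrite /= /next_prime; case: ex_minnP => p /andP[]. Qed.

Lemma nth_prime_ltS (j : nat) : (nth_prime j < nth_prime j.+1)%N.
Proof. by rewrite [nth_prime j.+1]/= /next_prime; case: ex_minnP => p /andP[]. Qed.

Lemma nth_prime_surj (p : nat) : prime p -> exists j, p = nth_prime j.+1.
Proof.
move=> pp; have lej j : (j <= nth_prime j)%N.
  by elim: j => // j IH; exact: leq_ltn_trans IH (nth_prime_ltS j).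
have ex_j : exists j, (p <= nth_prime j)%N by exists p; exact: lej.
case: (ex_minnP ex_j) => -[|j] le_p min_j.
- by move: le_p; rewrite leqn0 => /eqP p0; rewrite p0 in pp.
- exists j; apply/eqP; rewrite eqn_leq le_p /=.
  rewrite /next_prime; case: ex_minnP => q _; apply; rewrite pp andbT ltnNge.
  by apply/negP => /min_j; rewrite ltnn.
Qed.

(* The coefficient of b ^ (l - 1) in the base-b expansion of i (l >= 1). *)
Definition digit (b i l : nat) : nat := ((i %/ b ^ l.-1) %% b)%N.

Lemma digit_expansion (b i m : nat) : (0 < b)%N -> (i < b ^ m)%N ->
  i = (\sum_(1 <= l < m.+1) digit b i l * b ^ l.-1)%N.
Proof.
move=> b0; elim: m i => [|m IH] i.
  by rewrite expn0 ltnS leqn0 big_geq // => /eqP.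
move=> im; rewrite big_nat_recl //= {1}(divn_eq i b) addnC.
rewrite {1}/digit expn0 divn1 muln1; congr addn.
rewrite {1}(IH (i %/ b)%N); last by rewrite ltn_divLR // -expnSr.
rewrite big_distrl /=; apply: eq_big_nat => -[//|l] _.
by rewrite /digit /= -mulnA -expnSr -divnMA -expnS.
Qed.

Section Halton.
Variable R : realType.

(* The limit of the partial sums of sum_(l >= 1) digit_l b ^ (- l). *)
Definition radical_inverse (b i : nat) : R :=
  limn (fun m => \sum_(1 <= l < m) (digit b i l)%:R / b%:R ^+ l : R).

(* All but finitely many digits vanish, so the limit exists. *)
Lemma radical_inverse_finite (b i m : nat) : (0 < b)%N -> (i < b ^ m)%N ->
  radical_inverse b i = \sum_(1 <= l < m.+1) (digit b i l)%:R / b%:R ^+ l.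
Proof.
move=> b0 im; apply: lim_near_cst => //.
near=> n; have mn : (m.+1 <= n)%N by near: n; exact: nbhs_infty_ge.
rewrite (big_cat_nat _ mn) //= [X in _ + X]big_nat_cond [X in _ + X]big1 ?addr0 // => l.
rewrite andbT => /andP[ml _].
rewrite /digit divn_small ?mod0n ?mul0r //; apply: leq_trans im _.
by rewrite leq_pexp2l // -ltnS (ltn_predK ml).
Unshelve. all: by end_near. Qed.

(* Coordinates are indexed by 'I_d = {0, ..., d - 1}: the ordinal j stands for
   the coordinate j + 1, whose base is the (j + 1)-th prime. *)
Definition halton (d i : nat) (j : 'I_d) : R :=
  radical_inverse (nth_prime j.+1) i.

Definition same_cell (d : nat) (j : 'I_d) (m i i' : nat) : bool :=
  let b : R := (nth_prime j.+1)%:R in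
  Num.floor (b ^+ m * halton i j) == Num.floor (b ^+ m * halton i' j).

(* A vector in N_0^u is a function on the subtype of the elements of u. *)
Definition gain (d : nat) (u : {set 'I_d})
    (k : {j : 'I_d | j \in u} -> nat) (n : nat) : R :=
  n%:R^-1 *
  (\prod_(j in u) ((nth_prime j.+1)%:R - 1)^-1) *
  \sum_(i < n) \sum_(i' < n) \prod_(j : {j : 'I_d | j \in u})
    ((nth_prime (val j).+1)%:R * (same_cell (val j) (k j).+1 i i')%:R
     - (same_cell (val j) (k j) i i')%:R).

End Halton.
Arguments gain R {d u} k n.

(* Main.v *)
(* Two Halton points share a cell of side [b ^ - m] in base [b] iff their indices
   agree modulo [b ^ m], so the double sum is the quadratic form, at the
   all-ones vector, of a product of kernels [b 1(mod b^(k+1)) - 1(mod b^k)].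
   Each of these is positive semidefinite and, as a quadratic form, below
   [b 1(mod b^(k+1))]; by the Schur product argument all factors but one may be
   replaced by that upper bound. If [n] is at most the common period, the Chinese
   remainder theorem then leaves only the diagonal terms plus nonpositive ones,
   so the form is at most [n (b0 - 1)] times the product of the other bases. For
   larger [n] complete periods contribute nothing. Hence the gain is at most the
   product of [b / (b - 1)] over all coordinates of [u] but one, and this one is
   chosen to be that of the prime 2 whenever it is in [u]. *)
Require Import Defs.
From mathcomp Require Import all_boot all_order all_algebra.
From mathcomp Require Import all_classical all_reals all_analysis.
From mathcomp Require Import ring lra.

Import Order.TTheory GRing.Theory Num.Theory.
Import numFieldNormedType.Exports.

Local Open Scope classical_set_scope.
Local Open Scope ring_scope.

(** * Congruence kernels and positive semidefinite forms *)

Section Kernels.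
Variable R : realFieldType.
Implicit Types (K : nat -> nat -> R) (w : nat -> R) (n m b : nat).

Definition eqmod m i i' : R := (i == i' %[mod m])%:R.

Definition gain_factor b k i i' : R :=
  b%:R * eqmod (b ^ k.+1) i i' - eqmod (b ^ k) i i'.

(** Positivity is asked of every leading block of the infinite matrix [K]. *)
Definition psd K := forall n w,
  0 <= \sum_(i < n) \sum_(i' < n) w i * w i' * K i i'.

Lemma eqmodC m i i' : eqmod m i i' = eqmod m i' i.
Proof. by rewrite /eqmod eq_sym. Qed.

Lemma eqmod_ge0 m i i' : 0 <= eqmod m i i'.
Proof. exact: ler0n. Qed.

Lemma eqmod_modl m d i i' : (m %| d)%N -> eqmod m (i %% d) i' = eqmod m i i'.
Proof. by move=> md; rewrite /eqmod modn_dvdm. Qed.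

Lemma gain_factorC b k i i' : gain_factor b k i i' = gain_factor b k i' i.
Proof. by rewrite /gain_factor !(eqmodC _ i). Qed.

Lemma gain_factor_modl b k d i i' : (b ^ k.+1 %| d)%N ->
  gain_factor b k (i %% d) i' = gain_factor b k i i'.
Proof.
move=> bd; rewrite /gain_factor !eqmod_modl //.
by apply: dvdn_trans bd; rewrite dvdn_exp2l.
Qed.

Lemma psd_ext K K' : (forall i i', K i i' = K' i i') -> psd K -> psd K'.
Proof.
move=> KK' psdK n w; rewrite (le_trans (psdK n w)) //.
by under eq_bigr do under eq_bigr do rewrite KK'.
Qed.

Lemma psdD K K' : psd K -> psd K' -> psd (fun i i' => K i i' + K' i i').
Proof.
move=> psdK psdK' n w; rewrite (le_trans (addr_ge0 (psdK n w) (psdK' n w))) //.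
rewrite -big_split /=; under eq_bigr do rewrite -big_split /=.
by under eq_bigr do under eq_bigr do rewrite -mulrDr.
Qed.

Lemma psdZ (a : R) K : 0 <= a -> psd K -> psd (fun i i' => a * K i i').
Proof.
move=> a0 psdK n w; rewrite (le_trans (mulr_ge0 a0 (psdK n w))) //.
rewrite big_distrr /=; under eq_bigr do rewrite big_distrr /=.
by under eq_bigr do under eq_bigr do rewrite mulrCA.
Qed.

(** Schur's argument: the form of the product at [w] is the sum over [c] of the forms of [K] at the
    vectors [w i * g c i]. *)
Lemma psd_mul_gram K m (g : nat -> nat -> R) : psd K ->
  psd (fun i i' => K i i' * \sum_(c < m) g c i * g c i').
Proof.
move=> psdK n w.
rewrite (@le_trans _ _ (\sum_(c < m) \sum_(i < n) \sum_(i' < n)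
    (w i * g c i) * (w i' * g c i') * K i i')) //.
  by apply: sumr_ge0 => c _; exact: (psdK n (fun i => w i * g c i)).
rewrite exchange_big /=; under eq_bigr do rewrite exchange_big /=.
apply: ler_sum => i _; apply: ler_sum => i' _.
rewrite !big_distrr /=; apply: ler_sum => c _.
by rewrite le_eqVlt; apply/orP; left; apply/eqP; ring.
Qed.

(** * Sums over residue classes *)

Lemma sum_eqmod m x (f : nat -> R) : (0 < m)%N ->
  \sum_(c < m) eqmod m c x * f c = f (x %% m)%N.
Proof.
move=> m0; rewrite (bigD1 (Ordinal (ltn_pmod x m0))) //= big1 ?addr0.
  by rewrite /eqmod modn_mod eqxx mul1r.
move=> c ncx; rewrite /eqmod modn_small //.
case: eqP => [cx|_]; last by rewrite mul0r.
by case/eqP: ncx; apply: val_inj.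
Qed.

Lemma sum_periodic b m (f : nat -> R) : (forall c, f (c %% m)%N = f c) ->
  \sum_(c < b * m) f c = b%:R * \sum_(c < m) f c.
Proof.
move=> fm; rewrite -(big_mkord xpredT) big_nat_mul.
rewrite (eq_bigr (fun=> \sum_(c < m) f c)) => [|t _].
  by rewrite sumr_const_nat subn0 mulr_natl.
rewrite -[(t * m)%N]add0n mulSn big_addn addnK -(big_mkord xpredT).
by apply: eq_bigr => c _; rewrite -(fm (c + _)%N) addnC modnMDl fm.
Qed.

(** By the Chinese remainder theorem, [c] runs over all pairs of residues modulo [m] and [l] exactly
    once. *)
Lemma sum_coprime m l (f g : nat -> R) : coprime m l ->
    (forall c, f (c %% m)%N = f c) -> (forall c, g (c %% l)%N = g c) ->
  \sum_(c < m * l) f c * g c = (\sum_(c < m) f c) * \sum_(c < l) g c.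
Proof.
move=> co fm gl.
have [->|m0] := posnP m; first by rewrite mul0n !big_ord0 mul0r.
have [->|l0] := posnP l; first by rewrite muln0 !big_ord0 mulr0.
pose h (c : 'I_(m * l)) := (Ordinal (ltn_pmod c m0), Ordinal (ltn_pmod c l0)).
have h_inj : injective h.
  move=> c c' [/eqP cm /eqP cl]; apply: val_inj => /=.
  have : (c == c' %[mod m * l])%N by rewrite chinese_remainder // cm cl.
  by rewrite !modn_small // => /eqP.
have h_bij : bijective h.
  by apply: inj_card_bij => //; rewrite card_prod !card_ord.
rewrite big_distrlr /= pair_bigA /= (reindex h) /=; last exact: onW_bij.
by apply: eq_bigr => c _; rewrite fm gl.
Qed.

(** * Gram representations and Schur products *)

Lemma eqmod_gram m x y : (0 < m)%N ->
  eqmod m x y = \sum_(c < m) eqmod m c x * eqmod m c y.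
Proof.
by move=> m0; rewrite (sum_eqmod m x (fun c => eqmod m c y)) // eqmod_modl.
Qed.

(* The matrix of [gain_factor b k] modulo [b ^ k.+1] is [b] times a projection. *)
Lemma gain_factor_gram b k x y : (0 < b)%N ->
  gain_factor b k x y =
  b%:R^-1 * \sum_(c < b ^ k.+1) gain_factor b k c x * gain_factor b k c y.
Proof.
move=> b0; have bR : b%:R != 0 :> R by rewrite pnatr_eq0 -lt0n.
have dv : (b ^ k %| b ^ k.+1)%N by rewrite dvdn_exp2l.
have FF : \sum_(c < b ^ k.+1) eqmod (b ^ k) c x * eqmod (b ^ k) c y
    = b%:R * eqmod (b ^ k) x y.
  rewrite expnS (@sum_periodic b (b ^ k)
    (fun c => eqmod (b ^ k) c x * eqmod (b ^ k) c y)) => [|c].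
    by rewrite -eqmod_gram ?expn_gt0 ?b0.
  by rewrite !eqmod_modl.
have EE : \sum_(c < b ^ k.+1) eqmod (b ^ k.+1) c x * eqmod (b ^ k.+1) c y
    = eqmod (b ^ k.+1) x y by rewrite -eqmod_gram ?expn_gt0 ?b0.
have EF z t : \sum_(c < b ^ k.+1) eqmod (b ^ k.+1) c z * eqmod (b ^ k) c t
    = eqmod (b ^ k) z t
  by rewrite (sum_eqmod _ z (fun c => eqmod (b ^ k) c t)) ?expn_gt0 ?b0 //
    eqmod_modl.
(* The four terms of the expanded product, evaluated by [EE], by [EF] for both cross terms, and by
   [FF]. *)
transitivity (b%:R^-1 * (b%:R ^+ 2 * eqmod (b ^ k.+1) x y
   - b%:R * eqmod (b ^ k) x y - b%:R * eqmod (b ^ k) y x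
   + b%:R * eqmod (b ^ k) x y)).
  by rewrite /gain_factor [eqmod _ y x]eqmodC; field.
congr (_ * _); rewrite -{2}FF -EE -(EF x y) -(EF y x) !big_distrr /=.
rewrite -!sumrB -big_split /=; apply: eq_bigr => c _.
rewrite /gain_factor; ring.
Qed.

Lemma psd_mul_eqmod m K : (0 < m)%N -> psd K ->
  psd (fun i i' => K i i' * eqmod m i i').
Proof.
move=> m0 /(psd_mul_gram _ m (eqmod m)); apply: psd_ext => i i'.
by rewrite -eqmod_gram.
Qed.

Lemma psd_mul_gain_factor b k K : (0 < b)%N -> psd K ->
  psd (fun i i' => K i i' * gain_factor b k i i').
Proof.
move=> b0 /(psd_mul_gram _ (b ^ k.+1) (gain_factor b k)).
move/(psdZ b%:R^-1); rewrite invr_ge0 ler0n => /(_ isT).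
by apply: psd_ext => i i'; rewrite mulrCA -gain_factor_gram.
Qed.

Lemma psd1 : psd (fun _ _ => 1).
Proof.
move=> n w; rewrite (_ : \sum_(i < n) _ = (\sum_(i < n) w i) ^+ 2) ?sqr_ge0 //.
rewrite expr2 big_distrlr /=.
by apply: eq_bigr => i _; apply: eq_bigr => i' _; rewrite mulr1.
Qed.

(* Factor by factor, the difference is [eqmod (p j ^ k j)] times psd kernels,
   and products of these kernels stay psd. *)
Lemma psd_gain_prod_dominated (I : Type) (s : seq I) (p k : I -> nat) K :
    (forall j, 0 < p j)%N -> psd K ->
  psd (fun i i' => K i i' *
    (\prod_(j <- s) ((p j)%:R * eqmod (p j ^ (k j).+1) i i')
     - \prod_(j <- s) gain_factor (p j) (k j) i i')).
Proof.
move=> p0; elim: s K => [|j s IH] K psdK.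
  apply: (psd_ext (fun i i' => 0 * K i i')); last exact: psdZ.
  by move=> i i'; rewrite !big_nil subrr mul0r mulr0.
have psd_prod K' : psd K' -> psd (fun i i' => K' i i' *
    \prod_(j <- s) ((p j)%:R * eqmod (p j ^ (k j).+1) i i')).
  elim: {IH} s K' => [|l s IHs] K' psdK'.
    by apply: psd_ext psdK' => i i'; rewrite big_nil mulr1.
  have := IHs _ (psdZ (p l)%:R _ (ler0n _ _)
    (psd_mul_eqmod (p l ^ (k l).+1) _ _ psdK')).
  rewrite expn_gt0 p0 => /(_ isT); apply: psd_ext => i i'.
  by rewrite big_cons; ring.
have pj0 : (0 < p j ^ k j)%N by rewrite expn_gt0 p0.
(* With [A] the dominating factor at [j], [F] the gain factor and [e = A - F] the coarser
   congruence, [A * PA - F * PF = F * (PA - PF) + e * PA], where [PA] and [PF] are the products over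
   [s]. *)
have := psdD _ _ (IH _ (psd_mul_gain_factor _ (k j) _ (p0 j) psdK))
  (psd_prod _ (psd_mul_eqmod _ _ pj0 psdK)).
by apply: psd_ext => i i'; rewrite !big_cons /gain_factor; ring.
Qed.

(** * Complete periods and coprime moduli *)

(** A period meets the class of [x] once modulo [b ^ k.+1], with weight [b], and [b] times modulo
    [b ^ k]. *)
Lemma sum_gain_factor b k x : (0 < b)%N ->
  \sum_(c < b ^ k.+1) gain_factor b k c x = 0.
Proof.
move=> b0; rewrite /gain_factor sumrB -big_distrr /=.
have s1 m : (0 < m)%N -> \sum_(c < m) eqmod m c x = 1.
  move=> m0; rewrite -[RHS](sum_eqmod m x (fun=> 1)) //.
  by under [RHS]eq_bigr do rewrite mulr1.
rewrite s1 ?expn_gt0 ?b0 // expnS.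
rewrite (@sum_periodic b (b ^ k) (fun c => eqmod (b ^ k) c x)) => [|c].
  by rewrite s1 ?expn_gt0 ?b0 // subrr.
by rewrite eqmod_modl.
Qed.

(** The first [N] rows and, by symmetry, columns contribute zero; periodicity shifts the remaining
    indices back to start at 0. *)
Lemma double_sum_period N K n :
    (forall i i', K i i' = K i' i) -> (forall i i', K (i %% N)%N i' = K i i') ->
    (forall i', \sum_(i < N) K i i' = 0) ->
  \sum_(i < N + n) \sum_(i' < N + n) K i i' = \sum_(i < n) \sum_(i' < n) K i i'.
Proof.
move=> KC KN K0.
have shift i' : \sum_(i < N + n) K i i' = \sum_(i < n) K i i'.
  rewrite big_split_ord /= K0 add0r; apply: eq_bigr => i _.
  by rewrite -KN modnDl KN.
rewrite exchange_big /=; under eq_bigr do rewrite shift.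
rewrite exchange_big /=; apply: eq_bigr => i _.
by under eq_bigr do rewrite KC; rewrite shift; under eq_bigr do rewrite KC.
Qed.

Lemma coprime_bigprod (I : eqType) (s : seq I) (m : I -> nat) a :
  {in s, forall j, coprime a (m j)} -> coprime a (\prod_(j <- s) m j).
Proof.
move=> co; rewrite big_seq; elim/big_ind: _ => [|x y cx cy|j /co//].
  exact: coprimen1.
by rewrite coprimeMr cx.
Qed.

Lemma eqmod_prod (I : eqType) (s : seq I) (m : I -> nat) i i' :
    uniq s -> {in s &, forall j l, j != l -> coprime (m j) (m l)} ->
  eqmod (\prod_(j <- s) m j) i i' = \prod_(j <- s) eqmod (m j) i i'.
Proof.
elim: s => [|j s IH] /=; first by rewrite !big_nil /eqmod !modn1 eqxx.
move=> /andP[js us] co; rewrite !big_cons -IH //; last first.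
  by move=> l l' ls l's; apply: co; rewrite in_cons ?ls ?l's orbT.
rewrite /eqmod chinese_remainder -?mulnb ?natrM //.
apply: coprime_bigprod => l ls; apply: co; rewrite ?mem_head ?in_cons ?ls ?orbT //.
by apply: contraNneq js => ->.
Qed.

(** * The quadratic form for distinct primes *)

Section Bound.
Variables (I : finType) (p k : I -> nat) (j0 : I).
Hypotheses (p_prime : forall j, prime (p j)) (p_inj : injective p).

Let p0 j : (0 < p j)%N. Proof. exact: prime_gt0. Qed.
Let N := (\prod_j p j ^ (k j).+1)%N.
Let H i i' : R := \prod_j gain_factor (p j) (k j) i i'.

Let coprime_powers j l : j != l -> coprime (p j ^ (k j).+1) (p l ^ (k l).+1).
Proof.
move=> jl; rewrite coprime_pexpl // coprime_pexpr // prime_coprime //.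
by rewrite dvdn_prime2 //; apply: contra jl => /eqP/p_inj->.
Qed.

Let dvdN j : (p j ^ (k j).+1 %| N)%N.
Proof. by rewrite /N (bigD1 j) //= dvdn_mulr. Qed.

Lemma gain_kernelC i i' : H i i' = H i' i.
Proof. by apply: eq_bigr => j _; rewrite gain_factorC. Qed.

Lemma gain_kernel_modl i i' : H (i %% N)%N i' = H i i'.
Proof. by apply: eq_bigr => j _; rewrite gain_factor_modl. Qed.

(** The factor at [j0] splits off by coprimality, and its sum over a period vanishes. *)
Lemma sum_gain_kernel i' : \sum_(i < N) H i i' = 0.
Proof.
pose M := (\prod_(j | j != j0) p j ^ (k j).+1)%N.
have NE : N = (M * p j0 ^ (k j0).+1)%N by rewrite /N (bigD1 j0) //= mulnC.
have dvdM j : j != j0 -> (p j ^ (k j).+1 %| M)%N.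
  by move=> jj0; rewrite /M (bigD1 j) //= dvdn_mulr.
rewrite NE; under eq_bigr do rewrite /H (bigD1 j0) //= mulrC.
rewrite (@sum_coprime M (p j0 ^ (k j0).+1)
  (fun c => \prod_(j | j != j0) gain_factor (p j) (k j) c i')
  (fun c => gain_factor (p j0) (k j0) c i')).
- by rewrite sum_gain_factor // mulr0.
- rewrite coprime_sym /M -big_filter; apply: coprime_bigprod => j.
  by rewrite mem_filter => /andP[jj0 _]; apply: coprime_powers; rewrite eq_sym.
- by move=> c; apply: eq_bigr => j jj0; rewrite gain_factor_modl ?dvdM.
- by move=> c; rewrite gain_factor_modl.
Qed.

Lemma gain_sum_le_short n : (n <= N)%N ->
  \sum_(i < n) \sum_(i' < n) H i i'
  <= n%:R * (((p j0)%:R - 1) * \prod_(j | j != j0) (p j)%:R).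
Proof.
move=> nN; set Q := \prod_(j | j != j0) _.
have Q0 : 0 <= Q by apply: prodr_ge0 => j _; exact: ler0n.
pose E i i' : R := \prod_(j | j != j0) eqmod (p j ^ (k j).+1) i i'.
have E0 i i' : 0 <= E i i' by apply: prodr_ge0 => j _; exact: eqmod_ge0.
(* Every factor except the one at [j0] is replaced by its dominating kernel, with the psd factor at
   [j0] as multiplier and the all-ones vector as [w]. *)
apply: (@le_trans _ _ (\sum_(i < n) \sum_(i' < n)
    gain_factor (p j0) (k j0) i i' * (Q * E i i'))).
  rewrite -subr_ge0 -sumrB.
  have := psd_gain_prod_dominated I [seq j <- index_enum I | j != j0] p k _
    p0 (psd_mul_gain_factor _ (k j0) _ (p0 j0) psd1).
  move/(_ n (fun=> 1)); congr (0 <= _); apply: eq_bigr => i _.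
  rewrite -sumrB; apply: eq_bigr => i' _.
  by rewrite !mul1r !big_filter big_split /= /H [in RHS](bigD1 j0) //= mulrBr.
rewrite (_ : n%:R * _ = \sum_(i < n) \sum_(i' < n)
    (i == i' :> nat)%:R * (((p j0)%:R - 1) * Q)); last first.
  rewrite -[n in LHS]card_ord -sum1_card natr_sum big_distrl /=.
  apply: eq_bigr => i _; rewrite (bigD1 i) //= eqxx big1 ?addr0 // => i' ii'.
  by rewrite eq_sym (negPf (ii' : (i' != i :> nat))) mul0r.
apply: ler_sum => i _; apply: ler_sum => i' _.
(* On the diagonal all congruences hold and the bound is an equality. *)
have [ii'|ii'] := eqVneq (i : nat) i'.
  rewrite ii' /gain_factor /E /eqmod eqxx big1 => [|j _]; last by rewrite eqxx.
  by rewrite eqxx !mulr1 mul1r.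
(* Distinct indices below [N] cannot agree modulo all the prime powers, so only the negative part of
   the factor at [j0] survives. *)
have EN : eqmod (p j0 ^ (k j0).+1) i i' * E i i' = 0.
  transitivity (\prod_j eqmod (p j ^ (k j).+1) i i').
    by rewrite [in RHS](bigD1 j0).
  rewrite -(@eqmod_prod _ _ (fun j => (p j ^ (k j).+1)%N))
    ?index_enum_uniq //; last first.
    by move=> j l _ _; exact: coprime_powers.
  rewrite /eqmod !modn_small ?(negPf ii') //.
  - exact: leq_trans (ltn_ord i') nN.
  - exact: leq_trans (ltn_ord i) nN.
rewrite mul0r /gain_factor mulrBl subr_le0.
rewrite [leLHS](_ : _ = (p j0)%:R * Q *
    (eqmod (p j0 ^ (k j0).+1) i i' * E i i')).
  by rewrite EN mulr0 !mulr_ge0 ?eqmod_ge0.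
by ring.
Qed.

(** Strong induction: removing a full period keeps the double sum and only lowers the bound. *)
Lemma gain_sum_le n :
  \sum_(i < n) \sum_(i' < n) H i i'
  <= n%:R * (((p j0)%:R - 1) * \prod_(j | j != j0) (p j)%:R).
Proof.
have N0 : (0 < N)%N by apply: prodn_gt0 => j; rewrite expn_gt0 p0.
have C0 : 0 <= ((p j0)%:R - 1) * \prod_(j | j != j0) (p j)%:R :> R.
  by rewrite mulr_ge0 ?prodr_ge0 // subr_ge0 ler1n.
elim/ltn_ind: n => n IH; have [|Nn] := leqP n N; first exact: gain_sum_le_short.
rewrite -(subnKC (ltnW Nn)) double_sum_period; first last.
- exact: sum_gain_kernel.
- exact: gain_kernel_modl.
- exact: gain_kernelC.
apply: le_trans (IH _ _) _; first by rewrite ltn_subrL N0 (leq_trans _ Nn).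
by rewrite ler_wpM2r // ler_nat leq_addl.
Qed.
End Bound.
End Kernels.

(** * Digit reversal in base [b] *)

Lemma eq_mulD_small B x y r s : (r < B)%N -> (s < B)%N ->
  (x * B + r == y * B + s)%N = (x == y) && (r == s).
Proof.
move=> rB sB; apply/eqP/andP=> [e|[/eqP-> /eqP->]//].
have B0 : (0 < B)%N by exact: leq_ltn_trans rB.
split; apply/eqP.
  by have := congr1 (divn^~ B) e; rewrite !divnMDl // !divn_small // !addn0.
by have := congr1 (modn^~ B) e; rewrite !modnMDl !modn_small.
Qed.

Lemma modn_mul b B i : (0 < b)%N -> (0 < B)%N ->
  (i %% (b * B) = (i %/ b) %% B * b + i %% b)%N.
Proof.
move=> b0 B0; rewrite {1}(divn_eq i b) {1}(divn_eq (i %/ b) B).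
rewrite mulnDl -addnA -mulnA [(B * b)%N]mulnC modnMDl modn_small //.
rewrite (@leq_trans ((i %/ b %% B).+1 * b)) //.
  by rewrite mulSn addnC ltn_add2r ltn_pmod.
by rewrite mulnC leq_mul2l ltn_pmod // orbT.
Qed.

(** The lowest [m] digits of [i] read backwards, so that the units digit becomes the leading one. *)
Fixpoint rev_digits (b m i : nat) : nat :=
  if m is m'.+1 then (i %% b * b ^ m' + rev_digits b m' (i %/ b))%N else 0.

Lemma rev_digits_lt b m i : (0 < b)%N -> (rev_digits b m i < b ^ m)%N.
Proof.
move=> b0; elim: m i => [|m IH] i //=.
rewrite (@leq_trans ((i %% b).+1 * b ^ m)) //.
  by rewrite mulSn addnC ltn_add2r IH.
by rewrite expnS leq_mul2r ltn_pmod // orbT.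
Qed.

Lemma eq_rev_digits b m i i' : (0 < b)%N ->
  (rev_digits b m i == rev_digits b m i') = (i == i' %[mod b ^ m]).
Proof.
move=> b0; elim: m i i' => [|m IH] i i'; first by rewrite !modn1.
rewrite /= eq_mulD_small ?rev_digits_lt // IH expnS !modn_mul ?expn_gt0 ?b0 //.
by rewrite eq_mulD_small ?ltn_pmod // andbC.
Qed.

(** * Cells of the Halton points as residue classes *)

Section Halton.
Variable R : realType.

Lemma radical_inverse_rec b i : (1 < b)%N ->
  radical_inverse R b i =
  ((i %% b)%:R + radical_inverse R b (i %/ b)) / b%:R.
Proof.
move=> b1; have b0 := ltnW b1; have ib : (i < b ^ i)%N by exact: ltn_expl.
(* Since [i < b ^ i], cutting at [i.+1] digits on the left and [i] on the right is exact, and the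
   two sums match after a shift by one digit. *)
rewrite (@radical_inverse_finite R b i i.+1) //; last first.
  by rewrite (ltn_trans ib) // ltn_exp2l.
rewrite (@radical_inverse_finite R b (i %/ b) i) //; last first.
  by rewrite (leq_ltn_trans (leq_div _ _)).
rewrite big_nat_recl // mulrDl big_distrl /=; congr (_ + _).
  by rewrite /digit /= divn1 expr1.
rewrite [LHS]big_nat [RHS]big_nat; apply: eq_bigr => -[//|l] _.
rewrite /digit /= expnS divnMA exprS invfM; ring.
Qed.

Lemma radical_inverse_itv b i : (1 < b)%N ->
  0 <= radical_inverse R b i < 1.
Proof.
move=> b1; elim/ltn_ind: i => i IH; have [->|i0] := posnP i.
  by rewrite (@radical_inverse_finite R b 0 0) ?(ltnW b1) //
    big_geq ?lexx ?ltr01.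
have bR : 0 < b%:R :> R by rewrite ltr0n (ltnW b1).
have /IH/andP[x0 x1] : (i %/ b < i)%N by exact: ltn_Pdiv.
rewrite radical_inverse_rec // divr_ge0 ?addr_ge0 ?ler0n //=.
rewrite ltr_pdivrMr // mul1r.
have : (i %% b).+1%:R <= b%:R :> R by rewrite ler_nat ltn_pmod // ltnW.
by rewrite -natr1; lra.
Qed.

(** The recursions of [radical_inverse] and [rev_digits] both peel off the units digit; after [m]
    steps a radical inverse in [[0, 1)] is left as fractional part. *)
Lemma floor_radical_inverse b m i : (1 < b)%N ->
  Num.floor (b%:R ^+ m * radical_inverse R b i) = rev_digits b m i.
Proof.
move=> b1; apply: floor_def; rewrite intrD mulr1z -pmulrn.
elim: m i => [|m IH] i; first by rewrite expr0 mul1r add0r; exact: radical_inverse_itv.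
have bR : b%:R != 0 :> R by rewrite pnatr_eq0 -lt0n ltnW.
have /andP[l u] := IH (i %/ b)%N.
have -> : b%:R ^+ m.+1 * radical_inverse R b i =
    (i %% b * b ^ m)%N%:R + b%:R ^+ m * radical_inverse R b (i %/ b).
  by rewrite radical_inverse_rec // natrM natrX exprS; field.
by rewrite /= natrD -addrA lerD2l ltrD2l l.
Qed.

Lemma nth_prime_gt1 j : (1 < nth_prime j.+1)%N.
Proof. exact: prime_gt1 (nth_prime_prime j). Qed.

Lemma same_cellE d (j : 'I_d) m i i' :
  same_cell R j m i i' = (i == i' %[mod nth_prime j.+1 ^ m]).
Proof.
rewrite /same_cell /halton !floor_radical_inverse ?nth_prime_gt1 //.
by rewrite eqz_nat eq_rev_digits // ltnW ?nth_prime_gt1.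
Qed.

Lemma nth_prime_inj : injective nth_prime.
Proof.
apply: incn_inj; apply: leq_mono; apply: homo_ltn nth_prime_ltS.
exact: ltn_trans.
Qed.

Lemma nth_prime1 : nth_prime 1 = 2.
Proof.
rewrite /= /next_prime; case: ex_minnP => p /andP[_ /prime_gt1 p1] /(_ 2 isT) p2.
by apply/eqP; rewrite eqn_leq p2.
Qed.

(** * Bounds on the gain coefficients *)

Let ratio j : R := (nth_prime j)%:R / ((nth_prime j)%:R - 1).

Lemma ratio_ge1 j : 1 <= ratio j.+1.
Proof.
have : 1 < (nth_prime j.+1)%:R :> R by rewrite ltr1n nth_prime_gt1.
by move=> p1; rewrite /ratio ler_pdivlMr ?subr_gt0 // mul1r gerBl.
Qed.

(** The factor [(p x)%:R - 1] of the quadratic form bound cancels the normalisation at [x], so the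
    ratio at [x] drops out. *)
Lemma gain_le d (u : {set 'I_d}) (k : {j : 'I_d | j \in u} -> nat) n
    (x : {j : 'I_d | j \in u}) : (0 < n)%N ->
  gain R k n <= \prod_(j in u | j != val x) ratio j.+1.
Proof.
move=> n0; pose p (y : {j : 'I_d | j \in u}) := nth_prime (val y).+1.
have p_inj : injective p.
  by move=> y z /nth_prime_inj[] /val_inj/val_inj.
have p1 y : 1 < (p y)%:R :> R by rewrite ltr1n nth_prime_gt1.
rewrite big_sub_cond /gain big_sub /=.
under [X in _ * X]eq_bigr => i _ do under eq_bigr => i' _ do
  under eq_bigr => y _ do rewrite !same_cellE -/(p y).
set S := \sum_(i < n) _.
have S_le : S <= n%:R * (((p x)%:R - 1) * \prod_(y | y != x) (p y)%:R).
  exact: (@gain_sum_le R _ p k x (fun y => nth_prime_prime _) p_inj n).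
have c0 : 0 <= n%:R^-1 * \prod_y ((p y)%:R - 1)^-1 :> R.
  rewrite mulr_ge0 ?invr_ge0 ?ler0n // prodr_ge0 // => y _.
  by rewrite invr_ge0 subr_ge0 ltW.
apply: le_trans (ler_wpM2l c0 S_le) _; rewrite (bigD1 x) //= /ratio big_split /=.
rewrite [leLHS](_ : _ = \prod_(y | y != x) (p y)%:R *
    \prod_(y | y != x) ((p y)%:R - 1)^-1) //.
have nR : n%:R != 0 :> R by rewrite pnatr_eq0 -lt0n.
have px : (p x)%:R - 1 != 0 :> R by rewrite subr_eq0 gt_eqF.
by field; rewrite nR px.
Qed.

Lemma gain_le_half d (u : {set 'I_d}) (k : {j : 'I_d | j \in u} -> nat) n :
  u != finset.set0 -> (0 < n)%N ->
  gain R k n <= 2^-1 * \prod_(1 <= j < d.+1) ratio j.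
Proof.
case: d u k => [|d] u k; first by case/set0Pn => -[].
move=> u0 n0.
(* The half cancels the factor [2 / (2 - 1)] of the prime 2. *)
have -> : 2^-1 * \prod_(1 <= j < d.+2) ratio j =
    \prod_(j < d.+1 | j != ord0) ratio j.+1.
  rewrite big_add1 /= big_mkord (bigD1 ord0) //= /ratio nth_prime1.
  by set Q := \prod_(_ < _ | _) _; field.
(* The dropped coordinate is that of the prime 2 if it lies in [u], and any element of [u]
   otherwise. *)
have [x hx] : exists x : {j : 'I_d.+1 | j \in u},
    forall j, j \in u -> j != val x -> j != ord0.
  have [u_0|u_0] := boolP (ord0 \in u).
    by exists (exist (fun j => is_true (j \in u)) ord0 u_0).
  have /set0Pn[j ju] := u0; exists (exist (fun j => is_true (j \in u)) j ju) => l lu _.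
  by apply: contraNneq u_0 => <-.
apply: le_trans (gain_le _ _ _ _ x n0) _.
(* Coordinates missing on the left are filled in with ratios that are at least 1. *)
rewrite big_mkcond [leRHS]big_mkcond; apply: ler_prod => j _.
case: ifPn => [/andP[ju jx]|_].
  by rewrite (hx j) // lexx (le_trans ler01 (ratio_ge1 _)).
by rewrite ler01 /=; case: ifP => // _; exact: ratio_ge1.
Qed.

End Halton.

(** * Passage to the suprema over [k], [u] and [n] *)

Theorem corollary3 (R : realType) (d : nat) (hd : (1 <= d)%N) :
  (ereal_sup [set
     \big[maxe/-oo]_(u : {set 'I_d} | u != finset.set0)
       ereal_sup [set (gain R k n)%:E | k in
                  [set: {j : 'I_d | j \in u} -> nat]]
     | n in [set n : nat | (1 <= n)%N]]
   <= (2^-1 * \prod_(1 <= j < d.+1)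
         ((nth_prime j)%:R / ((nth_prime j)%:R - 1)))%:E)%E.
Proof.
apply: ge_ereal_sup => _ [n /= n0 <-]; apply: bigmax_le => [|u u0].
  exact: leNye.
by apply: ge_ereal_sup => _ [k _ <-]; rewrite lee_fin gain_le_half.
Qed.
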